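(* Let $s\geq 4$ be an even integer. For all integers $n,k\geq 1$, \[ M_{s}(n,k)=\sum_{\substack{0\leq \ell\leq k\\ \ell\equiv 0,1\ (\mathrm{mod}\ s)}} M_{s}(n-k,k-\ell). \]
   Context: $M_s(n,k)$ denotes the number of partitions of $n$ into exactly $k$ parts in which every part occurs with multiplicity congruent to $0$ or $1$ modulo $s$. Conventions: $M_s(0,0)=1$, $M_s(m,0)=0$ for $m>0$, and $M_s(m,j)=0$ whenever $m<0$. *)

(* Defs.v *)
From mathcomp Require Import all_boot all_order all_algebra.

Set Implicit Arguments.
Unset Strict Implicit.
Unset Printing Implicit Defensive.

(* Partitions are weakly decreasing sequences of positive integers. *)
Definition is_partition (n : nat) (p : seq nat) : bool :=
  [&& sorted geq p, all (fun i => 0 < i) p & sumn p == n].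

Definition cong01 (s m : nat) : bool :=
  (m == 0 %[mod s]) || (m == 1 %[mod s]).

Definition mult_cong01 (s : nat) (p : seq nat) : bool :=
  all (fun i => cong01 s (count_mem i p)) p.

(* The parts of a partition of n are at most n, so ranging over tuples with
   entries in 'I_n.+1 loses no partition; see partitions_withP. *)
Definition partitions_with (s n k : nat) : {set k.-tuple 'I_n.+1} :=
  [set t : k.-tuple 'I_n.+1 |
     is_partition n (map val t) && mult_cong01 s (map val t)].

(* M_s(m, k), extended by 0 to negative m. *)
Definition M (s : nat) (m : int) (k : nat) : nat :=
  match m with
  | Posz n => #|partitions_with s n k|
  | Negz _ => 0
  end.

Lemma partitions_withP (s n k : nat) (p : seq nat) :
  reflect (exists2 t, t \in partitions_with s n k & p = map val t)
          [&& is_partition n p, size p == k & mult_cong01 s p].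
Proof.
apply: (iffP and3P) => [[pP /eqP szp mP]|[t + ->]]; last first.
  by rewrite inE size_map size_tuple eqxx => /andP[].
have le_n i : i \in p -> i < n.+1.
  case/and3P: pP => _ _ /eqP <- pi; rewrite ltnS.
  by rewrite (perm_sumn (perm_to_rem pi)) leq_addr.
have szt : size (map (@inord n) p) == k by rewrite size_map szp.
have e : p = map val (Tuple szt).
  by rewrite /= -map_comp map_id_in // => i /le_n ?; rewrite /= inordK.
by exists (Tuple szt); rewrite // inE -e pP mP.
Qed.

Lemma M00 (s : nat) : M s 0%:Z 0 = 1.
Proof.
rewrite /= -[RHS](@cards1 _ ([tuple] : 0.-tuple 'I_1)); congr #|pred_of_set _|.
by apply/setP => t; rewrite !inE tuple0; apply/esym/eqP.
Qed.

Lemma Mn0 (s n : nat) : 0 < n -> M s n%:Z 0 = 0.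
Proof.
move=> n0; apply/eqP; rewrite cards_eq0; apply/eqP/setP => t.
by rewrite !inE tuple0 /is_partition /= eq_sym eqn0Ngt n0.
Qed.

(* Main.v *)
Require Import Defs.
From mathcomp Require Import all_boot all_order all_algebra.
From mathcomp Require Import zify.

Set Implicit Arguments.
Unset Strict Implicit.
Unset Printing Implicit Defensive.

(** Sort the partitions of [n] into [k] parts by the number [l] of parts equal
    to [1]. Subtracting [1] from every part and dropping the [l] zeros leaves a
    partition of [n - k] into [k - l] parts, and it shifts the multiplicities
    of the parts other than [1]; so the multiplicity condition on the original
    partition is the one on the image together with the one on [l]. *)

(** Plain sequences put the partitions for all [n] and [k] in one type, whereas the tuple types of
    [partitions_with] depend on both. *)
Definition partition_seqs (s n k : nat) : seq (seq nat) :=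
  [seq map val (tval t) | t <- enum (partitions_with s n k)].

Lemma mem_partition_seqs s n k p :
  (p \in partition_seqs s n k) =
  [&& is_partition n p, size p == k & mult_cong01 s p].
Proof.
apply/mapP/partitions_withP => -[t tP ->]; exists t => //.
  by rewrite mem_enum in tP.
by rewrite mem_enum.
Qed.

Lemma uniq_partition_seqs s n k : uniq (partition_seqs s n k).
Proof.
rewrite map_inj_uniq ?enum_uniq // => t u /inj_map eq_tu.
by apply/val_inj/eq_tu/val_inj.
Qed.

Lemma size_partition_seqs s n k : size (partition_seqs s n k) = M s n%:Z k.
Proof. by rewrite size_map -cardE. Qed.

(** A value absent from [p] has multiplicity 0, which is always admissible. Quantifying over all [i]
    spares the shift of parts any membership side condition. *)
Lemma mult_cong01P s p :
  reflect (forall i, cong01 s (count_mem i p)) (mult_cong01 s p).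
Proof.
apply: (iffP allP) => [pP i|pP i _]; last exact: pP.
have [/pP //|/count_memPn ->] := boolP (i \in p).
by rewrite /cong01 eqxx.
Qed.

Lemma leq_size_sumn p : all (leq 1) p -> size p <= sumn p.
Proof. by elim: p => //= x p IHp /andP[x0 /IHp]; lia. Qed.

Lemma sumn_map_succn q : sumn (map succn q) = sumn q + size q.
Proof. by elim: q => //= x q ->; lia. Qed.

(** Undoes the subtraction of 1 from every part, with [l] the number of zeros dropped; the ones go
    last to keep the order weakly decreasing. *)
Definition succ_parts (l : nat) (q : seq nat) : seq nat :=
  map succn q ++ nseq l 1.

Lemma size_succ_parts l q : size (succ_parts l q) = size q + l.
Proof. by rewrite size_cat size_map size_nseq. Qed.

Lemma sumn_succ_parts l q : sumn (succ_parts l q) = sumn q + size q + l.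
Proof. by rewrite sumn_cat sumn_map_succn sumn_nseq mul1n. Qed.

Lemma count_succ_parts l q i :
  count_mem i.+1 (succ_parts l q) = count_mem i q + (i == 0) * l.
Proof.
rewrite count_cat count_map count_nseq /= eqSS [0 == i]eq_sym.
by congr addn; apply: eq_count.
Qed.

Lemma all_gt0_succ_parts l q : all (leq 1) (succ_parts l q).
Proof. by rewrite all_cat all_map all_nseq orbT andbT; apply/allP. Qed.

Lemma sorted_succ_parts l q : sorted geq (succ_parts l q) = sorted geq q.
Proof.
have geq_trans : transitive geq by move=> ? ? ? /=; lia.
rewrite !sorted_pairwise // pairwise_cat pairwise_map.
have -> : allrel geq (map succn q) (nseq l 1).
  by apply/allrelP => _ _ /mapP[x _ ->] /nseqP[-> _].
have -> : pairwise geq (nseq l 1).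
  by elim: l => //= l ->; rewrite andbT; apply/allP => _ /nseqP[-> _].
by rewrite andbT /=; apply: eq_pairwise => x y.
Qed.

Lemma count0_pos q : all (leq 1) q -> count_mem 0 q = 0.
Proof. by move=> q0; apply/count_memPn/negP => /(allP q0). Qed.

(** Since [q] has no zeros, the only ones are the [l] appended ones, and each larger part [i.+2]
    inherits the multiplicity of [i.+1] in [q]. *)
Lemma mult_cong01_succ_parts s l q : all (leq 1) q ->
  mult_cong01 s (succ_parts l q) = cong01 s l && mult_cong01 s q.
Proof.
move=> q0; apply/mult_cong01P/andP => [pP | [lP /mult_cong01P qP] [|i]].
- split; first by have := pP 1; rewrite count_succ_parts count0_pos // mul1n.
  apply/mult_cong01P => -[|i]; first by rewrite count0_pos // /cong01 eqxx.
  by have := pP i.+2; rewrite count_succ_parts addn0.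
- by rewrite (count0_pos (all_gt0_succ_parts l q)) /cong01 eqxx.
rewrite count_succ_parts; case: i => [|i]; last by rewrite addn0; apply: qP.
by rewrite count0_pos // mul1n.
Qed.

(** Positivity makes [l] recoverable as the number of ones; the shifted prefixes then have equal
    length, so the concatenations can be split. *)
Lemma succ_parts_inj l l' q q' : all (leq 1) q -> all (leq 1) q' ->
  succ_parts l q = succ_parts l' q' -> (l = l') * (q = q').
Proof.
move=> q0 q'0 eq_p.
have eq_l : l = l'.
  have := congr1 (count_mem 1) eq_p.
  by rewrite !count_succ_parts !count0_pos // !mul1n.
split=> //; move: (eq_p); rewrite /succ_parts eq_l => /eqP.
rewrite eqseq_cat; last first.
  by have := congr1 size eq_p; rewrite !size_succ_parts !size_map; lia.
by case/andP => /eqP /(inj_map succn_inj).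
Qed.

Lemma succ_parts_surj p : sorted geq p -> all (leq 1) p ->
  exists2 q, all (leq 1) q & p = succ_parts (count_mem 1 p) q.
Proof.
elim: p => [|x p IHp] /=; first by exists [::].
move=> path_p /andP[x0 p0].
have [q q0 eq_p] := IHp (path_sorted path_p) p0.
have [x1|x1] := eqVneq x 1; last first.
  (* Here [x >= 2], so [x.-1] is still a positive part and the count of ones is that of the tail. *)
  exists (x.-1 :: q); first by rewrite /= q0 andbT; lia.
  by rewrite /succ_parts /= prednK // add0n {1}eq_p.
(* Once the head is 1, monotonicity and positivity force every later part to be 1, so the preimage
   is empty. *)
have p1 : all (pred1 1) p.
  have /allP le_p1 : all (geq x) p.
    by apply: order_path_min path_p => ? ? ? /=; lia.
  by apply/allP => y py /=; have := le_p1 y py; have := allP p0 y py => /=; lia.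
exists [::] => //; rewrite x1 /succ_parts /=; congr cons.
by rewrite (eqP (etrans (esym (all_count _ _)) p1)); apply/all_pred1P.
Qed.

Lemma mem_partition_seqs_succ_parts s n k l q : k <= n -> l <= k ->
    all (leq 1) q ->
  (succ_parts l q \in partition_seqs s n k) =
  cong01 s l && (q \in partition_seqs s (n - k) (k - l)).
Proof.
move=> le_kn le_lk q0; rewrite !mem_partition_seqs /is_partition.
rewrite sorted_succ_parts all_gt0_succ_parts q0 sumn_succ_parts.
rewrite size_succ_parts mult_cong01_succ_parts //=.
have -> : (size q + l == k) = (size q == k - l) by lia.
case: (size q =P k - l) => [->|_]; last by rewrite !andbF.
(* As [l <= k], the last two terms add up to [k]; [k <= n] makes the truncated [n - k] exact. *)
have -> : (sumn q + (k - l) + l == n) = (sumn q == n - k) by lia.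
by case: (cong01 s l); rewrite ?andbF.
Qed.

Lemma partition_seqs_gt0 s n k p : p \in partition_seqs s n k ->
  all (leq 1) p.
Proof. by rewrite mem_partition_seqs => /and3P[/and3P[]]. Qed.

(** Both lists are duplicate-free, the second by injectivity of [succ_parts], so it suffices to
    compare members. *)
Lemma perm_partition_seqs s n k : k <= n ->
  perm_eq (partition_seqs s n k)
    [seq succ_parts l q | l <- [seq l <- iota 0 k.+1 | cong01 s l],
                          q <- partition_seqs s (n - k) (k - l)].
Proof.
move=> le_kn; apply: uniq_perm; first exact: uniq_partition_seqs.
  apply: allpairs_uniq_dep => [|l _|]; first by rewrite filter_uniq ?iota_uniq.
    exact: uniq_partition_seqs.
  move=> u v /allpairsPdep[l [q [_ /partition_seqs_gt0 q0 ->]]].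
  move=> /allpairsPdep[l' [q' [_ /partition_seqs_gt0 q'0 ->]]] /=.
  by case/(succ_parts_inj q0 q'0) => -> ->.
move=> p; apply/idP/allpairsPdep => [pP | [l [q [+ qP ->]]]]; last first.
  rewrite mem_filter mem_iota => /andP[lP le_lk].
  by rewrite mem_partition_seqs_succ_parts ?lP // (partition_seqs_gt0 qP).
have := pP; rewrite mem_partition_seqs => /and3P[/and3P[srt_p p0 _] /eqP szp _].
have [q q0 eq_p] := succ_parts_surj srt_p p0.
have le_lk : count_mem 1 p <= k by rewrite -szp count_size.
move: pP; rewrite {1}eq_p mem_partition_seqs_succ_parts // => /andP[lP qP].
by exists (count_mem 1 p), q; rewrite mem_filter lP mem_iota.
Qed.

Theorem theorem6 (s : nat) (hs : 4 <= s) (hs2 : ~~ odd s)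
    (n k : nat) (hn : 1 <= n) (hk : 1 <= k) :
  M s n%:Z k =
  \sum_(0 <= l < k.+1 | cong01 s l) M s (n%:Z - k%:Z)%R (k - l).
Proof.
have [le_kn | lt_nk] := leqP k n.
  rewrite -size_partition_seqs (perm_size (perm_partition_seqs s le_kn)).
  rewrite size_allpairs_dep sumnE big_map big_filter.
  apply: eq_bigr => l _; rewrite size_partition_seqs.
  by congr (M s _ _); lia.
(* When [n < k] both sides vanish: [k] positive parts sum to at least [k], and [M] is 0 at negative
   arguments. [Negz m] denotes -(m+1), hence the predecessor. *)
have -> : (n%:Z - k%:Z)%R = Negz (k - n).-1 by lia.
rewrite big1 // -size_partition_seqs; case E: partition_seqs => [//|p ps].
have : p \in partition_seqs s n k by rewrite E mem_head.
rewrite mem_partition_seqs => /and3P[/and3P[_ /leq_size_sumn]].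
by move=> le_p /eqP sum_p /eqP size_p _; rewrite sum_p size_p leqNgt lt_nk in le_p.
Qed.
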